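(* Let $m\ge1$ be an integer. Then for every integer $N\ge2$ the colored Jones polynomial of the torus knot $\mathcal{T}_{2,2m+1}$ satisfies $$J_{\mathcal{T}_{2,2m+1}}(N)=q^{m(1-N)}\,\frac{1-q^{1-2N}}{1-q^{-N}}-q^{m-(2m+1)N}\,\frac{1-q^{1-N}}{1-q^{-N}}\,J_{\mathcal{T}_{2,2m+1}}(N-1).$$
   Context: For a knot $\mathcal{K}$ and an integer $N\ge1$, $J_{\mathcal{K}}(N)\in\mathbb{Z}[q,q^{-1}]$ denotes the $N$-colored Jones polynomial (the quantum invariant associated with the $N$-dimensional irreducible representation of $sl(2)$), in the indeterminate $q$, normalized so that $J_{\text{unknot}}(N)=1$ for all $N$. $\mathcal{T}_{s,t}$ is the $(s,t)$ torus knot, for relatively prime $s,t$. The conventions for $q$ and chirality are those for which the following known formula of Morton holds: $$J_{\mathcal{T}_{s,t}}(N)=\frac{q^{\frac14 st(1-N^2)}}{q^{N/2}-q^{-N/2}}\sum_{r=-\frac{N-1}{2}}^{\frac{N-1}{2}}\left(q^{str^2-(s+t)r+\frac12}-q^{str^2-(s-t)r-\frac12}\right),$$ where $r$ runs in steps of $1$ from $-\frac{N-1}{2}$ to $\frac{N-1}{2}$. This formula may be taken as the definition of $J_{\mathcal{T}_{s,t}}(N)$. *)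

(* Defs.v *)
From HB Require Import structures.
From mathcomp Require Import all_boot all_order all_algebra.

Set Implicit Arguments.
Unset Strict Implicit.
Unset Printing Implicit Defensive.

Import Order.TTheory GRing.Theory Num.Theory.
Local Open Scope ring_scope.

(* The field of fractions of Z[u]. The indeterminate u plays the role of      *)
(* q^(1/4), so that all the fractional powers of q in Morton's formula are    *)
(* integer powers of u; Z[q, q^-1] embeds in this field.                      *)
Definition Qu : fieldType := {fraction {poly int}}.

Definition u : Qu := tofrac 'X.

Definition q : Qu := u ^+ 4.

(* The N-colored Jones polynomial of the (s,t) torus knot (s, t coprime,      *)
(* 1 <= N), normalized to be 1 on the unknot, by Morton's formula             *)
(*    q^(st(1-N^2)/4) / (q^(N/2) - q^(-N/2)) *                                *)
(*      \sum_r (q^(st r^2 - (s+t)r + 1/2) - q^(st r^2 - (s-t)r - 1/2))        *)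
(* with r = -(N-1)/2, -(N-3)/2, ..., (N-1)/2. Every exponent of q is          *)
(* multiplied by 4 to give an exponent of u, and h k = 2r, r = k - (N-1)/2.   *)
Definition torus_colored_jones (s t : int) (N : nat) : Qu :=
  let h (k : nat) : int := 2 * k%:Z - (N%:Z - 1) in
  u ^ (s * t * (1 - N%:Z ^+ 2)) / (u ^ (2 * N%:Z) - u ^ (- (2 * N%:Z))) *
  \sum_(k < N)
     (u ^ (s * t * h k ^+ 2 - 2 * (s + t) * h k + 2)
      - u ^ (s * t * h k ^+ 2 - 2 * (s - t) * h k - 2)).

(* Main.v *)
(** With [s = 2] the two exponents in Morton's formula are the values [f h] and
    [f (h + 1)] of one quadratic polynomial [f], where [h = 2r] runs in steps of
    [2]. Hence the sum for [N] is an alternating sum of [u ^ f j] over the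
    consecutive integers [1 - N <= j <= N]. The sum for [N - 1] has the same
    inner terms with opposite signs, so adding the two sums leaves only
    [u ^ f (1 - N) - u ^ f N]. *)
Require Import Defs.
From HB Require Import structures.
From mathcomp Require Import all_boot all_order all_algebra.
From mathcomp Require Import ring zify.

Set Implicit Arguments.
Unset Strict Implicit.
Unset Printing Implicit Defensive.

Import Order.TTheory GRing.Theory Num.Theory.
Local Open Scope ring_scope.

Lemma u_neq0 : u != 0.
Proof. by rewrite /u tofrac_eq0 polyX_eq0. Qed.

Lemma expu_neq1 (n : nat) : (0 < n)%N -> u ^+ n != 1.
Proof.
move=> n0; rewrite /u -tofracXn -tofrac1 tofrac_eq.
by apply/eqP => /(congr1 (size \o polyseq)) /=; rewrite size_polyXn size_poly1; lia.
Qed.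

(** This keeps the denominators [1 - u ^ a] nonzero, so that divisions by them can be cancelled. *)
Lemma expzu_neq1 (a : int) : a != 0 -> u ^ a != 1.
Proof.
case: a => [n|n] a0; first by apply: expu_neq1; lia.
by rewrite NegzE -exprnN invr_eq1 expu_neq1.
Qed.

Lemma expuD (a b : int) : u ^ (a + b) = u ^ a * u ^ b.
Proof. exact: expfzDr u_neq0. Qed.

Lemma expq (a : int) : q ^ a = u ^ (4 * a).
Proof. by rewrite /q exprnP exprz_exp. Qed.

Lemma expu_sub_inv (a : int) : u ^ a - u ^ (- a) = u ^ a * (1 - u ^ (- (2 * a))).
Proof. by rewrite mulrBr mulr1 -expuD; congr (_ - u ^ _); ring. Qed.

(** The values at [2k - n + 1] cancel except for [k = n]; those at [2k - n + 2] cancel the values at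
    [2k - n] with [k] moved up by one, leaving [k = 0]. *)
Lemma sum_step2_add_shift (V : zmodType) (F : int -> V) (n : nat) :
  \sum_(k < n.+1) (F (2 * k%:Z - n%:Z) - F (2 * k%:Z - n%:Z + 1))
  + \sum_(k < n) (F (2 * k%:Z - n%:Z + 1) - F (2 * k%:Z - n%:Z + 2))
  = F (- n%:Z) - F (n%:Z + 1).
Proof.
rewrite !sumrB big_ord_recl [X in _ - X + _]big_ord_recr /=.
rewrite [X in _ + X - _ + _](_ : _ = \sum_(k < n) F (2 * k%:Z - n%:Z + 2)); last first.
  by apply: eq_bigr => k _; congr F; rewrite /= /bump /=; lia.
rewrite (_ : 2 * 0%:Z - n%:Z = - n%:Z); last by lia.
rewrite (_ : 2 * n%:Z - n%:Z + 1 = n%:Z + 1); last by lia.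
by rewrite opprD [X in _ + X + _]addrC !addrA subrK addrAC addrK.
Qed.

(** Here [A / (B * y)] and [C / (a * z)] are Morton's prefactors for [n.+1] and [n], [G * x] is the
    boundary term and [S] the sum for [n]. *)
Lemma split_recursion (F : fieldType) (A B C G a x y z S : F) :
  B != 0 -> C != 0 -> a != 0 -> y != 0 -> z != 0 ->
  A / (B * y) * (G * x - S)
  = A * G / B * (x / y) - A * a / (C * B) * (z / y) * (C / (a * z) * S).
Proof. by move=> B0 C0 a0 y0 z0; field; rewrite ?B0 ?C0 ?a0 ?y0 ?z0. Qed.

(** At [t = 2m + 1] all exponents of [u] become multiples of 4, which gives the recursion in [q]. *)
Lemma torus_colored_jones2_recursion (t : int) (n : nat) : (0 < n)%N ->
  torus_colored_jones 2 t n.+1 =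
    u ^ (2 * t * - n%:Z + 2 * n%:Z)
      * ((1 - u ^ (- 8 * n%:Z - 4)) / (1 - u ^ (- 4 * n%:Z - 4)))
    - u ^ (- 2 * t * (2 * n%:Z + 1) - 2)
      * ((1 - u ^ (- 4 * n%:Z)) / (1 - u ^ (- 4 * n%:Z - 4)))
      * torus_colored_jones 2 t n.
Proof.
move=> n_gt0; rewrite /torus_colored_jones.
pose f (h : int) : int := 2 * t * h ^+ 2 - 2 * (2 + t) * h + 2.
have f_shift h : 2 * t * h ^+ 2 - 2 * (2 - t) * h - 2 = f (h + 1).
  by rewrite /f; ring.
have := sum_step2_add_shift (fun h => u ^ f h) n.
set S1 := \sum_(k < n.+1) _; set S0 := \sum_(k < n) _ => sumE.
rewrite (_ : \sum_(k < n.+1) _ = S1); last first.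
  apply: eq_bigr => k _; rewrite f_shift.
  by congr (u ^ f _ - u ^ f _); lia.
rewrite (_ : \sum_(k < n) _ = S0); last first.
  apply: eq_bigr => k _; rewrite f_shift.
  by congr (u ^ f _ - u ^ f _); lia.
have {sumE}-> : S1 = u ^ f (- n%:Z) - u ^ f (n%:Z + 1) - S0.
  by rewrite -sumE addrK.
(* In [f (n + 1) - f (- n)] the contributions of [t] cancel, leaving [- 8n - 4]. *)
have fNn : u ^ f (- n%:Z) - u ^ f (n%:Z + 1)
    = u ^ f (- n%:Z) * (1 - u ^ (- 8 * n%:Z - 4)).
  by rewrite mulrBr mulr1 -expuD; congr (_ - u ^ _); rewrite /f; ring.
rewrite fNn !expu_sub_inv.
have -> : - (2 * (2 * n.+1%:Z)) = - 4 * n%:Z - 4 by lia.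
have -> : - (2 * (2 * n%:Z)) = - 4 * n%:Z by lia.
have D1 : 1 - u ^ (- 4 * n%:Z - 4) != 0.
  by rewrite subr_eq0 eq_sym expzu_neq1 //; lia.
(* Here [0 < n] matters: at [n = 0] this factor vanishes. *)
have D0 : 1 - u ^ (- 4 * n%:Z) != 0.
  by rewrite subr_eq0 eq_sym expzu_neq1 //; lia.
(* The two coefficients take the shapes [A * G / B] and [A * a / (C * B)] of [split_recursion]. *)
have -> : u ^ (2 * t * - n%:Z + 2 * n%:Z)
    = u ^ (2 * t * (1 - n.+1%:Z ^+ 2)) * u ^ f (- n%:Z) / u ^ (2 * n.+1%:Z).
  rewrite invr_expz -!expuD; congr (u ^ _).
  by rewrite /f (_ : n.+1%:Z = n%:Z + 1); [ring | lia].
have -> : u ^ (- 2 * t * (2 * n%:Z + 1) - 2)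
    = u ^ (2 * t * (1 - n.+1%:Z ^+ 2)) * u ^ (2 * n%:Z)
      / (u ^ (2 * t * (1 - n%:Z ^+ 2)) * u ^ (2 * n.+1%:Z)).
  rewrite -expuD -expuD invr_expz -!expuD; congr (u ^ _).
  by rewrite (_ : n.+1%:Z = n%:Z + 1); [ring | lia].
have uz a : u ^ a != 0 by apply: expfz_neq0; apply: u_neq0.
rewrite (@split_recursion _ _ _ (u ^ (2 * t * (1 - n%:Z ^+ 2))) _
  (u ^ (2 * n%:Z)) _ _ (1 - u ^ (- 4 * n%:Z))); first reflexivity.
- exact: uz.
- exact: uz.
- exact: uz.
- exact: D1.
- exact: D0.
Qed.

Theorem theorem6 (m : nat) (hm : (1 <= m)%N) (N : nat) (hN : (2 <= N)%N) :
  torus_colored_jones 2 (2 * m%:Z + 1) N =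
    q ^ (m%:Z * (1 - N%:Z)) *
      ((1 - q ^ (1 - 2 * N%:Z)) / (1 - q ^ (- N%:Z)))
    - q ^ (m%:Z - (2 * m%:Z + 1) * N%:Z) *
      ((1 - q ^ (1 - N%:Z)) / (1 - q ^ (- N%:Z))) *
      torus_colored_jones 2 (2 * m%:Z + 1) (N - 1).
Proof.
case: N hN => // n n_gt0.
rewrite subn1 torus_colored_jones2_recursion // !expq.
have -> : n.+1%:Z = n%:Z + 1 by lia.
congr (u ^ _ * ((1 - u ^ _) / (1 - u ^ _))
       - u ^ _ * ((1 - u ^ _) / (1 - u ^ _)) * _); ring.
Qed.
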